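(* Let $1\le n<m$, $q\in\mathbb C\setminus\{0\}$, and let $A=(a_{ij})_{m\times m}$ be a $q$-Cartier-Foata matrix, i.e. $$a_{jl}a_{ik}=a_{ik}a_{jl}\ (i<j,\ k<l),\quad a_{jl}a_{ik}=q^2a_{ik}a_{jl}\ (i<j,\ k>l),\quad a_{jk}a_{ik}=q\,a_{ik}a_{jk}\ (i<j).$$ For $n<i,j\le m$ let $$c^q_{ij}=-{\det}_q^{-1}(I-A_0)\cdot{\det}_q\begin{pmatrix} I-A_0 & -a_{*j}\\ -a_{i*} & -a_{ij}\end{pmatrix},\qquad C^q=(c^q_{ij})_{n+1\le i,j\le m}.$$ Then ${\det}_q^{-1}(I-A_0)\cdot{\det}_q(I-A)={\det}_q(I-C^q)$.
   Context: $\mathcal A$ is the $\mathbb C$-algebra of formal power series in non-commuting variables $a_{ij}$, $1\le i,j\le m$; identities are in the quotient by the closed two-sided ideal generated by the stated relations. $A_0=(a_{ij})_{1\le i,j\le n}$, $a_{i*}=(a_{i1},\dots,a_{in})$, $a_{*j}=(a_{1j},\dots,a_{nj})^T$. For words $\lambda,\mu$ over $\{1,\dots,m\}$ of equal length, $a_{\lambda,\mu}=a_{\lambda_1\mu_1}\cdots a_{\lambda_\ell\mu_\ell}$ and $\operatorname{inv}$ denotes number of inversions; the weight is $w(\lambda,\mu)=q^{\operatorname{inv}\mu-\operatorname{inv}\lambda}$. For a square matrix $B=(b_{rs})_{N\times N}$ with row labels $\rho_1<\dots<\rho_N$ and column labels $\kappa_1<\dots<\kappa_N$ in $\{1,\dots,m\}$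 and entries linear combinations of $1$ and $a_{\rho_r\kappa_s}$, ${\det}_qB$ is obtained by expanding $\sum_{\sigma\in S_N}(-1)^{\operatorname{inv}\sigma}b_{\sigma(1)1}\cdots b_{\sigma(N)N}$ into words $a_{\lambda,\mu}$ ($\lambda$ row labels, $\mu$ column labels) and multiplying each by $w(\lambda,\mu)$; this applies to $I-A$, $I-A_0$ and to the bordered matrix with rows labelled $1,\dots,n,i$ and columns $1,\dots,n,j$. Thus ${\det}_q(I-A)=\sum_{J\subseteq[m]}(-1)^{|J|}\sum_{\sigma\in S_J}(-q)^{-\operatorname{inv}\sigma}a_{\sigma(j_1)j_1}\cdots a_{\sigma(j_k)j_k}$ for $J=\{j_1<\dots<j_k\}$. ${\det}_q^{-1}(I-A_0)$ is the inverse of ${\det}_q(I-A_0)$. ${\det}_q(I-C^q)=\sum_{J\subseteq\{n+1,\dots,m\}}(-1)^{|J|}\sum_{\sigma\in S_J}(-q)^{-\operatorname{inv}\sigma}c^q_{\sigma(j_1)j_1}\cdots c^q_{\sigma(j_k)j_k}$, treating the $c^q_{ij}$ as letters. *)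

(* Defs.v *)
From HB Require Import structures.
From mathcomp Require Import all_boot all_order all_algebra.
From mathcomp Require Import fingroup perm.
From mathcomp Require Import boolp classical_sets functions reals.
From mathcomp Require Import complex.

Set Implicit Arguments.
Unset Strict Implicit.
Unset Printing Implicit Defensive.

Import Order.TTheory GRing.Theory Num.Theory.
Local Open Scope ring_scope.

(* Formal power series with coefficients in K in non-commuting variables X,
   represented by their coefficient function on words; the additive and linear
   structures are pointwise, the product is the Cauchy product below. *)
Definition ncseries (K : fieldType) (X : Type) : Type := seq X -> K.

HB.instance Definition _ (K : fieldType) (X : Type) :=
  GRing.Zmodule.copy (ncseries K X) (seq X -> K).

Section NCSeriesRing.
Variables (K : fieldType) (X : Type).
Implicit Types (f g h : ncseries K X) (w : seq X).

Definition ncs_one : ncseries K X := fun w => (nilp w)%:R.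

Definition ncs_mul f g : ncseries K X :=
  fun w => \sum_(k < (size w).+1) f (take k w) * g (drop k w).

Lemma ncs_addE f g w : (f + g) w = f w + g w. Proof. by []. Qed.
Lemma ncs_oppE f w : (- f) w = - f w. Proof. by []. Qed.
Lemma ncs_zeroE w : (0 : ncseries K X) w = 0. Proof. by []. Qed.
Definition ncs_scale (a : K) f : ncseries K X := fun w => a * f w.

Lemma ncs_scaleA a b f : ncs_scale a (ncs_scale b f) = ncs_scale (a * b) f.
Proof. by apply/funext => w; rewrite /ncs_scale mulrA. Qed.

Lemma ncs_scale1 : left_id 1 ncs_scale.
Proof. by move=> f; apply/funext => w; rewrite /ncs_scale mul1r. Qed.

Lemma ncs_scaleDr : right_distributive ncs_scale +%R.
Proof.
by move=> a f g; apply/funext => w; rewrite ncs_addE /ncs_scale ncs_addE mulrDr.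
Qed.

Lemma ncs_scaleDl f : {morph ncs_scale^~ f : a b / a + b}.
Proof. by move=> a b; apply/funext => w; rewrite ncs_addE /ncs_scale mulrDl. Qed.

HB.instance Definition _ := GRing.Zmodule_isLmodule.Build K (ncseries K X)
  ncs_scaleA ncs_scale1 ncs_scaleDr ncs_scaleDl.

Lemma ncs_scaleE (a : K) f w : (a *: f) w = a * f w. Proof. by []. Qed.

Definition ncs_tail x f : ncseries K X := fun w => f (x :: w).

Lemma ncs_mul_cons f g x w : ncs_mul f g (x :: w) =
  f [::] * g (x :: w) + ncs_mul (ncs_tail x f) g w.
Proof. by rewrite /ncs_mul big_ord_recl. Qed.

Lemma ncs_mulA : associative ncs_mul.
Proof.
move=> f g h; apply/funext => w; elim: w f g h => [|x w IHw] f g h.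
  by rewrite /ncs_mul /= !big_ord1 /= mulrA.
have tailM : ncs_tail x (ncs_mul f g) =
    f [::] *: ncs_tail x g + ncs_mul (ncs_tail x f) g.
  by apply/funext => v; rewrite {1}/ncs_tail ncs_mul_cons.
rewrite !ncs_mul_cons IHw tailM [ncs_mul f g [::]]big_ord1 /=.
rewrite mulrDr mulrA -addrA; congr (_ + _).
rewrite /ncs_mul mulr_sumr -big_split /=.
by apply: eq_bigr => i _; rewrite ncs_addE ncs_scaleE mulrDl mulrA.
Qed.

Lemma ncs_mul1 : left_id ncs_one ncs_mul.
Proof.
move=> f; apply/funext => w.
rewrite /ncs_mul big_ord_recl take0 drop0 /ncs_one /= mul1r big1 ?addr0 // => i _.
by case: w i => [|x w] i; [case: i | rewrite /= mul0r].
Qed.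

Lemma ncs_mulr1 : right_id ncs_one ncs_mul.
Proof.
move=> f; apply/funext => w.
rewrite /ncs_mul big_ord_recr /= take_size drop_size /ncs_one mulr1.
rewrite big1 ?add0r // => i _.
by rewrite /nilp size_drop subn_eq0 leqNgt ltn_ord mulr0.
Qed.

Lemma ncs_mulDl : left_distributive ncs_mul +%R.
Proof.
move=> f g h; apply/funext => w; rewrite ncs_addE /ncs_mul -big_split.
by apply: eq_bigr => i _; rewrite ncs_addE mulrDl.
Qed.

Lemma ncs_mulDr : right_distributive ncs_mul +%R.
Proof.
move=> f g h; apply/funext => w; rewrite ncs_addE /ncs_mul -big_split.
by apply: eq_bigr => i _; rewrite ncs_addE mulrDr.
Qed.

Lemma ncs_one_neq0 : ncs_one != 0.
Proof.
by apply/eqP => /(congr1 (fun f => f [::])); rewrite ncs_zeroE => /eqP; rewrite oner_eq0.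
Qed.

HB.instance Definition _ := GRing.Zmodule_isNzRing.Build (ncseries K X)
  ncs_mulA ncs_mul1 ncs_mulr1 ncs_mulDl ncs_mulDr ncs_one_neq0.

Lemma ncs_oneE w : (1 : ncseries K X) w = (nilp w)%:R. Proof. by []. Qed.

Lemma ncs_mulE f g w :
  (f * g) w = \sum_(k < (size w).+1) f (take k w) * g (drop k w).
Proof. by []. Qed.

Lemma ncs_scaleAl (a : K) f g : a *: (f * g) = (a *: f) * g.
Proof.
apply/funext => w; rewrite ncs_scaleE !ncs_mulE mulr_sumr.
by apply: eq_bigr => i _; rewrite ncs_scaleE mulrA.
Qed.

HB.instance Definition _ :=
  GRing.Lmodule_isLalgebra.Build K (ncseries K X) ncs_scaleAl.

Lemma ncs_scaleAr (a : K) f g : a *: (f * g) = f * (a *: g).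
Proof.
apply/funext => w; rewrite ncs_scaleE !ncs_mulE mulr_sumr.
by apply: eq_bigr => i _; rewrite ncs_scaleE mulrCA.
Qed.

HB.instance Definition _ :=
  GRing.Lalgebra_isAlgebra.Build K (ncseries K X) ncs_scaleAr.

Definition ncs_unit : pred (ncseries K X) := fun f => f [::] != 0.

(* With c = f [::] and u = 1 - f / c, the inverse of f is the geometric series
   c^-1 * (1 + u + u ^ 2 + ...); since u [::] = 0, the powers of exponent
   greater than size w do not contribute to the coefficient of w. *)
Definition ncs_inv f : ncseries K X :=
  if f [::] == 0 then f else
  fun w => (f [::])^-1 *
    (\sum_(k < (size w).+1) (1 - (f [::])^-1 *: f) ^+ k) w.

Lemma ncs_mul_nil f g : (f * g) [::] = f [::] * g [::].
Proof. by rewrite ncs_mulE big_ord1. Qed.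

Lemma ncs_exp_small f k w :
  f [::] = 0 -> (size w < k)%N -> (f ^+ k) w = 0.
Proof.
move=> f0; elim: k w => // k IHk [|x w] ltwk.
  by rewrite exprS ncs_mul_nil f0 mul0r.
rewrite exprS ncs_mulE big_ord_recl take0 f0 mul0r add0r big1 // => i _.
by rewrite IHk ?mulr0 // size_drop /= subSS (leq_ltn_trans (leq_subr _ _)).
Qed.

Definition ncs_geom f N : ncseries K X :=
  (f [::])^-1 *: \sum_(k < N.+1) (1 - (f [::])^-1 *: f) ^+ k.

Lemma ncs_one_sub_nil f :
  f [::] != 0 -> (1 - (f [::])^-1 *: f) [::] = 0.
Proof.
by move=> f0; rewrite ncs_addE ncs_oppE ncs_scaleE ncs_oneE /= mulVf ?subrr.
Qed.

Lemma ncs_sumE (I : finType) (F : I -> ncseries K X) w :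
  (\sum_i F i) w = \sum_i F i w.
Proof. by elim/big_rec2: _ => // i y1 y2 _ <-. Qed.

Lemma ncs_invE f N w : f [::] != 0 -> (size w <= N)%N ->
  ncs_inv f w = ncs_geom f N w.
Proof.
move=> f0 leN; rewrite /ncs_inv (negPf f0) /ncs_geom ncs_scaleE; congr (_ * _).
set u := 1 - _.
rewrite !ncs_sumE (big_ord_widen N.+1 (fun k => (u ^+ k) w)) // big_mkcond.
apply: eq_bigr => k _; case: ltnP => // ltwk; rewrite ncs_exp_small //.
exact: ncs_one_sub_nil.
Qed.

Lemma ncs_geomP f N w : f [::] != 0 -> (size w <= N)%N ->
  (ncs_geom f N * f) w = (1 : ncseries K X) w /\
  (f * ncs_geom f N) w = (1 : ncseries K X) w.
Proof.
move=> f0 leN; rewrite /ncs_geom.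
pose u := 1 - (f [::])^-1 *: f; rewrite -/u; set G := \sum_(k < _) _.
have fE : (f [::])^-1 *: f = 1 - u by rewrite /u opprB addrC subrK.
have uw : (u ^+ N.+1) w = 0.
  by apply: ncs_exp_small => //; apply: ncs_one_sub_nil.
have G1 : (1 - u) * G = 1 - u ^+ N.+1 by rewrite -opprB mulNr -subrX1 opprB.
have GC : G * (1 - u) = (1 - u) * G.
  apply/commr_sym/commr_sum => i _; apply/commrX/commr_sym.
  by apply: commrB => //; apply: commr1.
rewrite -scalerAl -scalerAr (scalerAl _ f) (scalerAr _ G) fE GC G1.
by rewrite ncs_addE ncs_oppE uw subr0.
Qed.

Lemma ncs_mul_ext f f' g g' w :
    (forall v, (size v <= size w)%N -> f v = f' v) ->
    (forall v, (size v <= size w)%N -> g v = g' v) ->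
  (f * g) w = (f' * g') w.
Proof.
move=> ff' gg'; rewrite !ncs_mulE; apply: eq_bigr => i _.
by rewrite ff' ?gg' // ?size_drop ?leq_subr // size_take; case: ltnP => // /ltnW.
Qed.

Lemma ncs_mulV : {in ncs_unit, left_inverse 1 ncs_inv *%R}.
Proof.
move=> f f0; apply/funext => w.
rewrite -(ncs_geomP f0 (leqnn (size w))).1.
by apply: ncs_mul_ext => // v lev; apply: ncs_invE.
Qed.

Lemma ncs_divV : {in ncs_unit, right_inverse 1 ncs_inv *%R}.
Proof.
move=> f f0; apply/funext => w.
rewrite -(ncs_geomP f0 (leqnn (size w))).2.
by apply: ncs_mul_ext => // v lev; apply: ncs_invE.
Qed.

Lemma ncs_unitP f g : g * f = 1 /\ f * g = 1 -> ncs_unit f.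
Proof.
case=> /(congr1 (fun h => h [::])); rewrite ncs_mul_nil ncs_oneE => gf _.
by apply: contra_eq_neq gf => ->; rewrite mulr0 eq_sym oner_eq0.
Qed.

Lemma ncs_inv_out : {in [predC ncs_unit], ncs_inv =1 id}.
Proof. by move=> f; rewrite inE /= negbK /ncs_inv => ->. Qed.

HB.instance Definition _ := GRing.NzRing_hasMulInverse.Build (ncseries K X)
  ncs_mulV ncs_divV ncs_unitP ncs_inv_out.

(* Closedness refers to the topology in which two series are close when they
   agree on all words of length < d. *)
Record closed_ideal (I : set (ncseries K X)) : Prop := ClosedIdeal {
  closed_ideal0 : I 0;
  closed_idealD : forall f g, I f -> I g -> I (f + g);
  closed_idealMl : forall f g, I g -> I (f * g);
  closed_idealMr : forall f g, I f -> I (f * g);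
  closed_ideal_lim : forall f,
    (forall d, exists2 g, I g & forall w, (size w < d)%N -> g w = f w) -> I f
}.

Definition eqmod_closed_ideal (G : set (ncseries K X)) f g : Prop :=
  smallest closed_ideal G (f - g).

End NCSeriesRing.

Fixpoint inversions (s : seq nat) : nat :=
  if s is x :: s' then (count (fun y => (y < x)%N) s' + inversions s')%N else 0%N.

Section QDeterminant.
Variables (K : fieldType) (m : nat) (q : K).

(* The letter (i, j) is a_ij, so a word over 'I_m * 'I_m is a word
   a_{lambda, mu} with lambda and mu its first and second projections. *)
Notation S := (ncseries K ('I_m * 'I_m)).

Definition letter (x : 'I_m * 'I_m) : S := fun w => (w == [:: x])%:R.

Definition lettermx : 'M[S]_m := \matrix_(i, j) letter (i, j).

Definition qweight (w : seq ('I_m * 'I_m)) : K :=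
  q ^ ((inversions [seq val x.2 | x <- w])%:Z
       - (inversions [seq val x.1 | x <- w])%:Z).

(* The letters carry their own row and column labels, so the labels of B need
   not be supplied to weight the words of its expansion. *)
Definition detq N (B : 'M[S]_N) : S := fun w => qweight w *
  (\sum_(s : 'S_N) (-1) ^+ inversions [seq val (s r) | r <- enum 'I_N] *
     \prod_(r < N) B (s r) r) w.

(* det_q (I - C) for a matrix C with rows and columns indexed by D, its entries
   being treated as letters; enum J lists J in increasing order. *)
Definition detq_letters (D : {set 'I_m}) (C : 'I_m -> 'I_m -> S) : S :=
  \sum_(J : {set 'I_m} | J \subset D) (-1) ^+ #|J| *
    \sum_(s : 'S_m | perm_on J s)
      (- q) ^- inversions [seq val (s j) | j <- enum J] *:
        \prod_(j <- enum J) C (s j) j.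

Inductive qCartierFoata : set S :=
| qCF_lt (i j k l : 'I_m) of (i < j)%N & (k < l)%N :
    qCartierFoata (lettermx j l * lettermx i k - lettermx i k * lettermx j l)
| qCF_gt (i j k l : 'I_m) of (i < j)%N & (l < k)%N :
    qCartierFoata (lettermx j l * lettermx i k - q ^+ 2 *: (lettermx i k * lettermx j l))
| qCF_eq (i j k : 'I_m) of (i < j)%N :
    qCartierFoata (lettermx j k * lettermx i k - q *: (lettermx i k * lettermx j k)).

Section LeadingBlock.
Variables (n : nat) (le_nm : (n <= m)%N).

Definition leadmx : 'M[S]_n :=
  mxsub (widen_ord le_nm) (widen_ord le_nm) lettermx.

Definition bordermx (i j : 'I_m) : 'M[S]_(n + 1) :=
  block_mx
    (1%:M - leadmx)                               (- \col_r lettermx (widen_ord le_nm r) j)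
    (- \row_r lettermx i (widen_ord le_nm r))       (const_mx (- lettermx i j)).

Definition cq (i j : 'I_m) : S :=
  - ((detq (1%:M - leadmx))^-1 * detq (bordermx i j)).

End LeadingBlock.
End QDeterminant.

Arguments letter {K m} x.
Arguments lettermx {K m}.
Arguments leadmx {K m n} le_nm.
Arguments qCartierFoata {K m} q.

(* Main.v *)
Require Import Defs.
From HB Require Import structures.
From mathcomp Require Import all_boot all_order all_algebra.
From mathcomp Require Import fingroup perm.
From mathcomp Require Import generic_quotient ring_quotient.
From mathcomp Require Import boolp classical_sets functions reals.
From mathcomp Require Import complex.
From mathcomp Require Import zify.

Set Implicit Arguments.
Unset Strict Implicit.
Unset Printing Implicit Defensive.

Import Order.TTheory GRing.Theory Num.Theory.
Local Open Scope ring_scope.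

(* Multiplying the coefficient of every word (lambda, mu) by
   q^(inv mu - inv lambda), called twisting, carries ordinary column
   determinants to det_q. The series whose multiples all twist into the
   q-Cartier-Foata ideal form a two-sided ideal, and letters from different rows
   commute modulo it. So in the quotient the rows of I - A commute, and right
   column operations give det (I - A) = det (I - A_0) * det (I - W), where W_ij
   is the generating series of the walks i -> j with intermediate vertices <= n.
   The bordered determinant is the case of one extra row and column, equal to
   - det (I - A_0) * W_ij, so W_ij twists to c^q_ij. Twisting respects the
   products that occur, up to the power of q counted by the inversions between
   the factors: the intermediate labels of a walk appear in both lambda and mu
   and contribute nothing, and what remains is the weight in det_q (I - C^q). *)

(** * Quotient of a ring by a two-sided ideal *)

(** Turns congruence modulo an ideal into equality in a ring, where determinants can be computed.
    The target may be the zero ring, so the ideal may be everything. *)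
Lemma exists_quotient_morphism (R : pzRingType) (I : set R) :
    I 0 -> (forall x y, I x -> I y -> I (x + y)) ->
    (forall a x, I x -> I (a * x)) -> (forall a x, I x -> I (x * a)) ->
  exists (Q : pzRingType) (pi : {rmorphism R -> Q}), forall x, pi x = 0 <-> I x.
Proof.
move=> I0 ID IMl IMr.
pose J : {pred R} := fun x => `[< I x >].
have JE x : (x \in J) = `[< I x >] by [].
have JB : zmod_closed J.
  split=> [|x y]; first by rewrite JE; apply/asboolP.
  rewrite !JE => /asboolP Ix /asboolP Iy; apply/asboolP/ID => //.
  by rewrite -mulN1r; apply: IMl.
pose JZ : zmodClosed R := HB.pack J (GRing.isZmodClosed.Build R J JB).
pose Q := Quotient.quot JZ.
pose p : R -> Q := \pi_Q%qT.
have pE x y : (p x = p y) <-> I (x - y).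
  split=> [/eqP|Ixy]; first by rewrite -Quotient.idealrBE => /asboolP.
  by apply/eqP; rewrite -Quotient.idealrBE; apply/asboolP.
have pD x y : p (x + y) = p x + p y by exact: Quotient.pi_add.
pose mul (x y : Q) : Q := p (repr x * repr y).
have pM x y : p (x * y) = mul (p x) (p y).
  apply/pE; set x' := repr _; set y' := repr _.
  have Ix : I (x - x') by apply/pE; rewrite /p /x' reprK.
  have Iy : I (y - y') by apply/pE; rewrite /p /y' reprK.
  have -> : x * y - x' * y' = (x - x') * y + x' * (y - y').
    by rewrite mulrBl mulrBr addrA subrK.
  by apply: ID; [apply: IMr|apply: IMl].
have pK (x : Q) : p (repr x) = x by rewrite /p reprK.
have mulA : associative mul.
  by move=> x y z; rewrite -[x]pK -[y]pK -[z]pK -!pM mulrA.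
have mul1 : left_id (p 1) mul by move=> x; rewrite -[x]pK -!pM mul1r.
have mulr1 : right_id (p 1) mul by move=> x; rewrite -[x]pK -!pM mulr1.
have mulDl : left_distributive mul +%R.
  by move=> x y z; rewrite -[x]pK -[y]pK -[z]pK -pD -!pM mulrDl pD.
have mulDr : right_distributive mul +%R.
  by move=> x y z; rewrite -[x]pK -[y]pK -[z]pK -pD -!pM mulrDr pD.
pose QR : pzRingType :=
  HB.pack Q (GRing.Zmodule_isPzRing.Build Q mulA mul1 mulr1 mulDl mulDr).
pose p' : R -> QR := p.
have p0 : p' 0 = 0 by apply: (addrI (p' 0)); rewrite -[LHS]pD !addr0.
have pB : zmod_morphism p'.
  move=> x y; apply: (addIr (p' y)); rewrite subrK -[LHS]pD subrK //.
have pMm : monoid_morphism p' by split=> // x y; apply: pM.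
exists QR; exists (HB.pack p' (GRing.isZmodMorphism.Build R QR p' pB)
  (GRing.isMonoidMorphism.Build R QR p' pMm) : {rmorphism R -> QR}) => x /=.
by rewrite -p0; split=> [/pE|Ix]; [|apply/pE]; rewrite subr0.
Qed.

(** * Column determinants of matrices with commuting rows *)

Lemma enum_ord_cut N (j : 'I_N) :
  enum 'I_N = [seq r : 'I_N <- enum 'I_N | (r < j)%N] ++
              j :: [seq r : 'I_N <- enum 'I_N | (j < r)%N].
Proof.
apply: (inj_map val_inj); rewrite map_cat /= val_enum_ord.
rewrite -(filter_map val (fun r => r < j)%N) -(filter_map val (fun r => j < r)%N).
rewrite val_enum_ord; move: (nat_of_ord j) (ltn_ord j) => a ltaN.
have -> : iota 0 N = iota 0 a ++ a :: iota a.+1 (N - a.+1).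
  by rewrite -[in LHS](subnKC ltaN) addSnnS iotaD.
rewrite !filter_cat /= ltnn.
congr (_ ++ _ :: _).
  rewrite (all_filterP _); last by apply/allP => x; rewrite mem_iota.
  rewrite (eq_in_filter (a2 := pred0)) ?filter_pred0 ?cats0 // => x.
  by rewrite mem_iota => /andP[/ltnW]; rewrite leqNgt => /negPf.
rewrite (eq_in_filter (a2 := pred0)) ?filter_pred0 /=; last first.
  by move=> x; rewrite mem_iota => /= /ltnW; rewrite leqNgt => /negPf.
by rewrite (all_filterP _) //; apply/allP => x; rewrite mem_iota => /andP[].
Qed.

Section ColumnDeterminant.
Variable Q : pzRingType.

(* The Leibniz formula with the factors of each term ordered by columns. *)
Definition coldet N (X : 'M[Q]_N) : Q := \det X^T.

Lemma coldetE N (X : 'M[Q]_N) :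
  coldet X = \sum_(s : 'S_N) (-1) ^+ s * \prod_r X (s r) r.
Proof.
by apply: eq_bigr => s _; congr (_ * _); apply: eq_bigr => r _; rewrite mxE.
Qed.

Lemma prod_perm_eq (T : eqType) (F : T -> Q) (l1 l2 : seq T) :
    perm_eq l1 l2 -> {in l1 &, forall x y, x != y -> GRing.comm (F x) (F y)} ->
  \prod_(x <- l1) F x = \prod_(x <- l2) F x.
Proof.
elim: l1 l2 => [|x l1 IHl] l2 /[dup] eq12.
  by rewrite perm_sym => /perm_nilP ->.
have x2 : x \in l2 by rewrite -(perm_mem eq12) mem_head.
case/splitPr: x2 eq12 => u v.
rewrite perm_sym perm_catC cat_cons perm_cons perm_sym => eq12 _ comF.
rewrite big_cons (IHl (u ++ v)); first 1 last.
- by rewrite perm_sym perm_catC perm_sym.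
- by move=> y z y1 z1; apply: comF; rewrite inE ?y1 ?z1 orbT.
rewrite !big_cat big_cons /= !mulrA; congr (_ * _).
rewrite big_seq; suff : GRing.comm (F x) (\prod_(i <- u | i \in u) F i) by [].
apply: commr_prod => y yu; case: (eqVneq x y) => [-> // |neq].
by apply: comF; rewrite ?mem_head // inE (perm_mem eq12) mem_cat yu !orbT.
Qed.

Definition commuting_rows N (M : 'M[Q]_N) :=
  forall i j k l, i != j -> GRing.comm (M i k) (M j l).

Lemma big_ord_cut N (F : 'I_N -> Q) (j : 'I_N) :
  \prod_r F r = \prod_(r <- [seq r : 'I_N <- enum 'I_N | (r < j)%N]) F r * F j *
                \prod_(r <- [seq r : 'I_N <- enum 'I_N | (j < r)%N]) F r.
Proof.
have -> : \prod_r F r = \prod_(r <- enum 'I_N) F r by rewrite [index_enum _]unlock -enumT.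
by rewrite {1}(enum_ord_cut j) big_cat big_cons /= mulrA.
Qed.

(* The terms cancel in pairs under the exchange of the rows of columns k and j;
   the columns after j need not commute with anything. *)
Lemma coldet_repeat_col N (M Y : 'M[Q]_N) (k j : 'I_N) (h : Q) :
    commuting_rows M -> (k < j)%N ->
    (forall i (r : 'I_N), (r < j)%N -> Y i r = M i r) ->
    (forall i, Y i j = M i k * h) ->
  coldet Y = 0.
Proof.
move=> comM ltkj Ylt Yj; rewrite coldetE.
pose pre := [seq r : 'I_N <- enum 'I_N | (r < j)%N].
pose suf := [seq r : 'I_N <- enum 'I_N | (j < r)%N].
have neq_kj : k != j by apply: contraTneq ltkj => ->; rewrite ltnn.
(* Up to column [j], the term of [s] is a product of entries of [M] followed by [h]; [L s] lists the
   positions of these entries, column [j] counting as column [k]. *)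
pose entry (x : 'I_N * 'I_N) := M x.1 x.2.
pose L (s : 'S_N) := rcons [seq (s r, r) | r <- pre] (s j, k).
pose T (s : 'S_N) := \prod_(x <- L s) entry x * h *
                     \prod_(r <- suf) Y (s r) r.
have YT (s : 'S_N) : \prod_r Y (s r) r = T s.
  rewrite (big_ord_cut _ j) Yj mulrA /T; congr (_ * _ * _).
  rewrite /L -cats1 big_cat big_map big_seq1; congr (_ * _).
  by apply: eq_big_seq => r; rewrite mem_filter => /andP[ltrj _]; rewrite Ylt.
under eq_bigr do rewrite YT.
(* Composing with [t] flips the sign and permutes the list [L s]; distinct positions in it lie in
   distinct rows, so the reordered product is the same. *)
pose t := tperm k j.
rewrite (bigID (fun s : 'S_N => odd_perm s)) /=.
rewrite [X in X + _](reindex_inj (mulgI t)) /=.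
apply/eqP; rewrite addr_eq0 -sumrN; apply/eqP.
apply: eq_big => [s|s]; rewrite odd_permM odd_tperm neq_kj /=; first by [].
move=> odds; rewrite (negPf odds) expr1 expr0 mulN1r mul1r; congr (- _).
rewrite /T; congr (_ * _ * _); last first.
  rewrite /suf !big_filter; apply: eq_bigr => r ltjr.
  rewrite permM tpermD //; first by apply: contraTneq (ltn_trans ltkj ltjr) => ->; rewrite ltnn.
  by apply: contraTneq ltjr => ->; rewrite ltnn.
have kpre : k \in pre by rewrite mem_filter ltkj mem_enum.
have upre : uniq pre by rewrite filter_uniq ?enum_uniq.
have preD r : r \in pre -> r != j.
  by rewrite mem_filter => /andP[ltrj _]; apply: contraTneq ltrj => ->; rewrite ltnn.
apply: prod_perm_eq.
  have perm_pre : perm_eq pre (k :: rem k pre) by apply: perm_to_rem.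
  have EL (s' : 'S_N) : perm_eq (L s') [:: (s' j, k), (s' k, k) & [seq (s' r, r) | r <- rem k pre]].
    by rewrite /L perm_rcons perm_cons; apply: (perm_map (fun r => (s' r, r))) perm_pre.
  apply: (perm_trans (EL _)); rewrite perm_sym; apply: (perm_trans (EL _)).
  rewrite !permM tpermL tpermR.
  suff -> : [seq ((t * s)%g r, r) | r <- rem k pre] = [seq (s r, r) | r <- rem k pre].
    exact: (permEl (perm_catCA [:: _] [:: _] _)).
  apply/eq_in_map => r; rewrite mem_rem_uniq // inE => /andP[rk rpre].
  by rewrite permM tpermD // eq_sym // preD.
move=> x y xL yL neqxy; apply: comM.
have inL z : z \in L (t * s)%g -> exists2 c, z.1 = (t * s)%g c & z.2 = if c == j then k else c.
  rewrite mem_rcons inE => /orP[/eqP -> | /mapP[r rpre ->]] /=.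
    by exists j; rewrite ?eqxx.
  by exists r; rewrite ?(negPf (preD _ rpre)).
have [[c xc1 xc2] [d yd1 yd2]] := (inL _ xL, inL _ yL).
apply: contraNneq neqxy; rewrite xc1 yd1 => /perm_inj cd.
by rewrite [x]surjective_pairing [y]surjective_pairing xc1 xc2 yd1 yd2 cd.
Qed.

(* The columns are changed one at a time from the right end, so that those to
   the left of the current one are still the columns of M. *)
Lemma coldet_col_sub n p (M : 'M[Q]_(n + p)) (H : 'M[Q]_(n, p)) :
  commuting_rows M ->
  coldet M = coldet (row_mx (lsubmx M) (rsubmx M - lsubmx M *m H)).
Proof.
move=> comM; set T := row_mx _ _.
pose mix c : 'M[Q]_(n + p) := \matrix_(i, r) if (r < c)%N then M i r else T i r.
have mix0 : mix 0%N = T by apply/matrixP => i r; rewrite mxE.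
have mixN : mix (n + p)%N = M by apply/matrixP => i r; rewrite mxE ltn_ord.
suff main c : (c <= n + p)%N -> coldet (mix c) = coldet (mix 0%N).
  by rewrite -mix0 -mixN main.
elim: c => // c IHc ltc; rewrite -IHc; last exact: ltnW.
pose j := Ordinal ltc.
have [/= ltcn | lenc] := ltnP c n.
  congr coldet; apply/matrixP => i r; rewrite !mxE ltnS leq_eqVlt.
  case: eqVneq => //= rc; rewrite rc ltnn; case: splitP => [k rk | k rk].
    by rewrite mxE; congr (M i _); apply: val_inj.
  by move: ltcn; rewrite -rc rk ltnNge leq_addr.
have ltcp : (c - n < p)%N by rewrite ltn_subLR.
pose j' := Ordinal ltcp.
have jE : j = rshift n j' by apply: val_inj; rewrite /= subnKC.
(* By linearity in column [j], passing from [mix c.+1] to [mix c] subtracts the sum of the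
   determinants of these matrices, each of which repeats column [k] of [M] up to a right factor. *)
pose Y k : 'M[Q]_(n + p) := \matrix_(i, r)
  if r == j then M i (lshift p k) * H k j' else mix c i r.
have Y0 k : coldet (Y k) = 0.
  apply: (@coldet_repeat_col _ M _ (lshift p k) j (H k j')) => //=.
  - exact: leq_trans (ltn_ord k) lenc.
  - move=> i r ltrc; rewrite !mxE ltrc; case: eqP => // rj.
    by move: ltrc; rewrite rj ltnn.
  by move=> i; rewrite mxE eqxx.
have mixS s : \prod_r mix c.+1 (s r) r - \prod_r mix c (s r) r
     = \sum_k \prod_r Y k (s r) r.
  have outE (X X' : 'M[Q]_(n + p)) : (forall i r, r != j -> X i r = X' i r) ->
      forall l : seq 'I_(n + p), j \notin l ->
      \prod_(r <- l) X (s r) r = \prod_(r <- l) X' (s r) r.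
    move=> XX' l jl; apply: eq_big_seq => r rl; apply: XX'.
    by apply: contraNneq jl => <-.
  pose u := [seq r : 'I_(n + p) <- enum 'I_(n + p) | (r < j)%N].
  pose v := [seq r : 'I_(n + p) <- enum 'I_(n + p) | (j < r)%N].
  have ju : j \notin u by rewrite mem_filter ltnn.
  have jv : j \notin v by rewrite mem_filter ltnn.
  have Scut (X : 'M[Q]_(n + p)) : (forall i r, r != j -> X i r = mix c i r) ->
      \prod_r X (s r) r = \prod_(r <- u) mix c (s r) r * X (s j) j *
                         \prod_(r <- v) mix c (s r) r.
    by move=> XE; rewrite (big_ord_cut _ j) (outE _ _ XE) // (outE _ _ XE v).
  rewrite Scut => [|i r rj]; last first.
    by rewrite !mxE ltnS leq_eqVlt -[c]/(val j) val_eqE (negPf rj).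
  rewrite Scut // -mulrBl -mulrBr.
  have YE k : \prod_r Y k (s r) r = \prod_(r <- u) mix c (s r) r * Y k (s j) j *
                                   \prod_(r <- v) mix c (s r) r.
    by apply: Scut => i r rj; rewrite mxE (negPf rj).
  rewrite (eq_bigr _ (fun k _ => YE k)).
  rewrite -mulr_suml -mulr_sumr; congr (_ * _ * _).
  have -> : mix c.+1 (s j) j = M (s j) j by rewrite mxE ltnS leqnn.
  have -> : mix c (s j) j = T (s j) j by rewrite mxE ltnn.
  have -> : T (s j) j = M (s j) j - \sum_k M (s j) (lshift p k) * H k j'.
    rewrite {2 4}jE /T row_mxEr !mxE; congr (_ - _).
    by apply: eq_bigr => k _; rewrite mxE.
  by rewrite opprB addrC subrK; apply: eq_bigr => k _; rewrite mxE eqxx.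
apply/eqP; rewrite -subr_eq0 !coldetE -sumrB.
under eq_bigr do rewrite -mulrBr mixS mulr_sumr.
rewrite exchange_big big1 // => k _.
by rewrite -[RHS](Y0 k) coldetE.
Qed.
End ColumnDeterminant.

(** * Permutations that preserve two blocks of indices *)

Section BlockPermutation.
Variables n p : nat.

Definition block_perm_fun (s : 'S_n) (t : 'S_p) (x : 'I_(n + p)) : 'I_(n + p) :=
  match fintype.split x with
  | inl i => lshift p (s i)
  | inr j => rshift n (t j)
  end.

Lemma block_perm_inj s t : injective (block_perm_fun s t).
Proof.
move=> x y; rewrite /block_perm_fun -[x]splitK -[y]splitK !unsplitK.
case: (fintype.split x) (fintype.split y) => [i|i] [j|j] /eqP;
  rewrite ?(eq_lshift, eq_rshift, eq_lrshift, eq_rlshift) //;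
  by move=> /eqP/perm_inj ->.
Qed.

Definition block_perm s t : 'S_(n + p) := perm (@block_perm_inj s t).

Lemma block_perml s t i : block_perm s t (lshift p i) = lshift p (s i).
Proof. by rewrite permE /block_perm_fun (unsplitK (inl i)). Qed.

Lemma block_permr s t j : block_perm s t (rshift n j) = rshift n (t j).
Proof. by rewrite permE /block_perm_fun (unsplitK (inr j)). Qed.

(** The permutation matrix is block diagonal, so over the integers its determinant, the sign, is the
    product of the two signs. *)
Lemma odd_block_perm s t : odd_perm (block_perm s t) = odd_perm s (+) odd_perm t.
Proof.
have E : perm_mx (block_perm s t) = block_mx (perm_mx s) 0 0 (perm_mx t) :> 'M[int]_(n + p).
  apply/matrixP => x y; rewrite -[x]splitK -[y]splitK.
  case: (fintype.split x) (fintype.split y) => [i|i] [j|j] /=;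
    rewrite ?block_mxEul ?block_mxEur ?block_mxEdl ?block_mxEdr !mxE
      ?block_perml ?block_permr.
  - by rewrite eq_lshift.
  - by rewrite eq_lrshift.
  - by rewrite eq_rlshift.
  - by rewrite eq_rshift.
have := det_perm int (block_perm s t).
rewrite E det_ublock !det_perm -signr_addb.
by case: (block_perm s t : bool) (_ (+) _) => [] [].
Qed.

(** [u] maps the last block into itself, hence onto itself by counting, and injectivity then sends
    the first block into itself. *)
Lemma block_permP (u : 'S_(n + p)) :
  (forall j i, u (rshift n j) != lshift p i) -> exists st, u = block_perm st.1 st.2.
Proof.
move=> uR.
have uRE j : exists k, u (rshift n j) = rshift n k.
  rewrite -[u _]splitK; case: fintype.splitP (uR j) => [i Ei|k _ _]; last by exists k.
  by move=> /(_ i) /eqP[]; apply: val_inj.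
have uLE i : exists k, u (lshift p i) = lshift p k.
  pose B := [set rshift n j | j in 'I_p].
  have uB : [set u x | x in B] = B.
    apply/eqP; rewrite eqEcard (card_imset _ (@perm_inj _ u)) leqnn andbT.
    apply/fintype.subsetP => _ /imsetP[_ /imsetP[j _ ->] ->].
    by have [k ->] := uRE j; apply: imset_f.
  rewrite -[u _]splitK; case: fintype.splitP => [k _|k Ek]; first by exists k.
  have : u (lshift p i) \in [set u x | x in B].
    by rewrite uB; apply/imsetP; exists k => //; apply: val_inj.
  by case/imsetP => x /imsetP[j _ ->] /perm_inj /eqP; rewrite eq_lrshift.
pose sP (i : 'I_n) : {k | u (lshift p i) = lshift p k} := cid (uLE i).
pose tP (j : 'I_p) : {k | u (rshift n j) = rshift n k} := cid (uRE j).
have sI : injective (fun i => sval (sP i)).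
  move=> i i' /=; case: (sP i) (sP i') => /= k Ek [k' Ek'] E.
  by apply: (@lshift_inj _ p); apply: (@perm_inj _ u); rewrite Ek Ek' E.
have tI : injective (fun j => sval (tP j)).
  move=> j j' /=; case: (tP j) (tP j') => /= k Ek [k' Ek'] E.
  by apply: (@rshift_inj n); apply: (@perm_inj _ u); rewrite Ek Ek' E.
exists (perm sI, perm tI); apply/permP => x /=; rewrite -[x]splitK.
case: (fintype.split x) => [i|j] /=.
  by rewrite block_perml permE; case: (sP i).
by rewrite block_permr permE; case: (tP j).
Qed.

End BlockPermutation.

(** * Schur complements for column determinants *)

Section SchurComplement.
Variable Q : pzRingType.

(** A permutation sending a column of the last block to a row of the first one picks an entry of the
    zero block; the others are block permutations, in whose products the factors from [A] precede
    those from [D]. *)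
Lemma coldet_lblock n p (A : 'M[Q]_n) (C : 'M[Q]_(p, n)) (D : 'M[Q]_p) :
  coldet (block_mx A 0 C D) = coldet A * coldet D.
Proof.
rewrite !coldetE; set X := block_mx A 0 C D.
pose h (st : 'S_n * 'S_p) := block_perm st.1 st.2.
have hI : injective h.
  move=> [s t] [s' t'] /permP E; congr (_, _); apply/permP => i.
    by apply: (@lshift_inj _ p); have := E (lshift p i); rewrite !block_perml.
  by apply: (@rshift_inj n); have := E (rshift n i); rewrite !block_permr.
rewrite (bigID (fun u => u \in [set h st | st in [set: 'S_n * 'S_p]])) /=.
rewrite [X in _ + X]big1 ?addr0 => [|u uh]; last first.
  have [j [i uji]] : exists j i, u (rshift n j) = lshift p i.
    apply: contrapT => nu; case/negP: uh.
    have [|st ->] := @block_permP n p u; last by apply: imset_f; rewrite inE.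
    by move=> j i; apply/eqP => uji; apply: nu; exists j, i.
  by rewrite (big_ord_cut _ (rshift n j)) uji block_mxEur mxE mulr0 mul0r mulr0.
rewrite big_imset /=; last exact: in2W.
rewrite big_distrl /=; under [RHS]eq_bigr do rewrite big_distrr.
rewrite pair_big; apply: eq_big => [st|[s t] _ /=]; first by rewrite inE.
rewrite odd_block_perm signr_addb big_split_ord /=.
rewrite -!mulrA; congr (_ * _); rewrite mulrA [RHS]mulrA; congr (_ * _); last first.
  by apply: eq_bigr => j _; rewrite block_permr block_mxEdr.
rewrite -signr_odd; case: (odd _); rewrite ?mulN1r ?mulrN1 ?mul1r ?mulr1 ?mulN1r //=.
  by congr (- _); apply: eq_bigr => j _; rewrite block_perml block_mxEul.
by apply: eq_bigr => j _; rewrite block_perml block_mxEul.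
Qed.

(** [H] stands for the inverse of the upper left block times the upper right one; subtracting the
    first columns times [H] from the last ones clears the upper right block. *)
Lemma coldet_schur n p (M : 'M[Q]_(n + p)) (H : 'M[Q]_(n, p)) :
    commuting_rows M -> ulsubmx M *m H = ursubmx M ->
  coldet M = coldet (ulsubmx M) * coldet (drsubmx M - dlsubmx M *m H).
Proof.
move=> comM MH; rewrite (coldet_col_sub H comM) -(coldet_lblock _ (dlsubmx M)).
congr coldet; set ul := ulsubmx M; set dl := dlsubmx M; set dr := drsubmx M.
have ME : M = row_mx (col_mx ul dl) (col_mx (ursubmx M) dr).
  by rewrite -block_mxEh submxK.
rewrite {1 2 3}ME row_mxKl row_mxKr mul_col_mx MH opp_col_mx add_col_mx subrr.
by rewrite block_mxEh.
Qed.

Lemma coldet_1 n : coldet (1%:M : 'M[Q]_n) = 1.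
Proof.
rewrite coldetE (bigD1 1%g) //= odd_perm1 expr0 mul1r big1 => [|r _]; last first.
  by rewrite perm1 mxE eqxx.
rewrite big1 ?addr0 // => s; case: (pickP (fun r => s r != r)) => [r sr _|eq1 /eqP[]].
  by rewrite (big_ord_cut _ r) mxE (negPf sr) mulr0 mul0r mulr0.
by apply/permP => r; rewrite perm1; apply/eqP; have /negbFE := eq1 r.
Qed.

Lemma coldet_mx11 (X : 'M[Q]_1) : coldet X = X 0 0.
Proof.
rewrite coldetE (big_pred1 1%g) => [|s]; first by rewrite odd_perm1 mul1r big_ord1 perm1.
by apply/esym/eqP/permP => i; rewrite !ord1.
Qed.

(** [J] is the set of columns whose factor is taken from [- C]. The other factors come from the
    identity and vanish unless [s] fixes those columns. *)
Lemma coldet_1sub N (C : 'M[Q]_N) :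
  coldet (1%:M - C) = \sum_(J : {set 'I_N}) (-1) ^+ #|J| *
     \sum_(s : 'S_N | perm_on J s) (-1) ^+ s * \prod_(j <- enum J) C (s j) j.
Proof.
rewrite coldetE.
under eq_bigr => s _.
  under eq_bigr => r _ do rewrite mxE [(- C) _ _]mxE addrC.
  rewrite bigA_distr big_distrr; over.
rewrite exchange_big; apply: eq_bigr => J _; rewrite big_distrr /= [RHS]big_mkcond /=.
apply: eq_bigr => s _; case: ifP => [Js|/negbT nJs].
  rewrite [RHS]mulrA [(-1) ^+ #|J| * _]commr_sign -[RHS]mulrA; congr (_ * _).
  have -> : \prod_(j <- enum J) C (s j) j = \prod_(j in J) C (s j) j.
    by rewrite -[RHS]big_filter [index_enum _]unlock.
  rewrite -prodrN [RHS]big_mkcond; apply: eq_bigr => r _; case: ifP => // /negbT rJ.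
  by rewrite mxE (out_perm Js) // eqxx.
have [r rJ sr] : exists2 r, r \notin J & s r != r.
  apply/exists_inP; apply: contraNT nJs; rewrite negb_exists_in => /forall_inP nJs.
  by apply/fintype.subsetP => r; rewrite inE; apply: contraR => /nJs; rewrite negbK.
by rewrite (big_ord_cut _ r) (negPf rJ) mxE (negPf sr) mulr0 mul0r mulr0.
Qed.

End SchurComplement.

(** * Inversions of words and parity of permutations *)

(** Number of inversions of [u ++ v] between an entry of [u] and a later entry of [v]. *)
Definition cross (u v : seq nat) : nat := \sum_(x <- u) count (fun y => (y < x)%N) v.

Lemma inversions_cat u v :
  inversions (u ++ v) = (inversions u + inversions v + cross u v)%N.
Proof.
elim: u => [|x u IHu] /=; first by rewrite /cross big_nil addn0.
by rewrite IHu count_cat /cross big_cons; lia.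
Qed.

Lemma cross_catl u1 u2 v : cross (u1 ++ u2) v = (cross u1 v + cross u2 v)%N.
Proof. exact: big_cat. Qed.

Lemma cross_catr u v1 v2 : cross u (v1 ++ v2) = (cross u v1 + cross u v2)%N.
Proof. by rewrite /cross -big_split; apply: eq_bigr => x _; rewrite count_cat. Qed.

Lemma cross_perm u u' v v' : perm_eq u u' -> perm_eq v v' -> cross u v = cross u' v'.
Proof.
move=> uu' /seq.permP vv'; rewrite /cross (perm_big _ uu') /=.
by apply: eq_bigr => x _; apply: vv'.
Qed.

Lemma inversions_map f u :
  {mono f : x y / (x < y)%N} -> inversions (map f u) = inversions u.
Proof.
move=> fmono; elim: u => //= x u ->; congr (_ + _)%N.
by rewrite count_map; apply: eq_count => y /=; rewrite fmono.
Qed.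

Lemma inversions_sorted u : sorted ltn u -> inversions u = 0%N.
Proof.
elim: u => //= x u IHu pathu; rewrite IHu; last exact: path_sorted pathu.
rewrite addn0; apply/eqP; rewrite -leqn0 leqNgt -has_count; apply/hasPn => y yu.
by have /allP/(_ y yu) := order_path_min ltn_trans pathu; rewrite -leqNgt => /ltnW.
Qed.

(** By the counting hypothesis, as many entries of [a] exceed [x] as entries of [b] lie below it, so
    [x] takes part in an even number of inversions. A fixed point of a permutation is in this
    situation. *)
Lemma odd_inversions_insert a b x :
    x \notin a -> count (fun y => (y < x)%N) (a ++ b) = size a ->
  odd (inversions (a ++ x :: b)) = odd (inversions (a ++ b)).
Proof.
move=> xa; rewrite count_cat => cab.
have crossx : cross a [:: x] = count (fun y => (x < y)%N) a.
  elim: a {xa cab} => [|y a IHa]; first by rewrite /cross big_nil.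
  by rewrite /cross big_cons /= addn0; congr (_ + _)%N.
have cxa : (count (fun y => (y < x)%N) a + count (fun y => (x < y)%N) a = size a)%N.
  rewrite -(count_predC (fun y => (y < x)%N) a); congr (_ + _)%N.
  apply: eq_in_count => y ya /=; rewrite -leqNgt ltn_neqAle.
  by rewrite (_ : x != y) //; apply: contraNneq xa => ->.
rewrite -(cat1s x b) !inversions_cat cross_catr crossx /=.
have -> : cross [:: x] b = count (fun y => (y < x)%N) b by rewrite /cross big_seq1.
lia.
Qed.

Lemma count_lt_enum N k : (k <= N)%N -> count (fun r : 'I_N => (r < k)%N) (enum 'I_N) = k.
Proof.
move=> lekN; rewrite -(count_map val (fun r => r < k)%N) val_enum_ord.
rewrite -(subnKC lekN) iotaD count_cat -[RHS]addn0; congr (_ + _)%N.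
  rewrite -[RHS](size_iota 0); apply/eqP; rewrite -all_count.
  by apply/allP => x; rewrite mem_iota.
apply/eqP; rewrite -leqn0 leqNgt -has_count; apply/hasPn => x.
by rewrite mem_iota -leqNgt => /andP[].
Qed.

Lemma finset_enumT N : enum [set: 'I_N] = enum 'I_N.
Proof. by apply: eq_enum => x; rewrite finset.in_setT. Qed.

Lemma perm_onT N (s : 'S_N) : perm_on [set: 'I_N] s.
Proof. by apply/fintype.subsetP => x _; rewrite finset.in_setT. Qed.

Lemma perm_map_enum N (s : 'S_N) (J : {set 'I_N}) :
  perm_on J s -> perm_eq [seq s j | j <- enum J] (enum J).
Proof.
move=> Js; apply: uniq_perm; rewrite ?enum_uniq //.
  by rewrite (map_inj_uniq (@perm_inj _ s)) enum_uniq.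
move=> y; rewrite mem_enum; apply/mapP/idP => [[x]|yJ].
  by rewrite mem_enum => xJ ->; rewrite perm_closed.
by exists (s^-1 y)%g; rewrite ?permKV // mem_enum -(perm_closed _ Js) permKV.
Qed.

Lemma lift_permP N (s : 'S_N.+1) : exists s', s = lift_perm ord0 (s ord0) s'.
Proof.
have sP k : {k' | s (lift ord0 k) = lift (s ord0) k'}.
  have : s ord0 != s (lift ord0 k) by rewrite (inj_eq perm_inj) neq_lift.
  by move=> /unlift_some[k' -> _]; exists k'.
have sI : injective (fun k => sval (sP k)).
  move=> k l /=; case: (sP k) (sP l) => /= k' Ek [l' El] kl.
  by apply: (@lift_inj _ ord0); apply: (@perm_inj _ s); rewrite Ek El kl.
exists (perm sI); apply/permP => x; case: (unliftP ord0 x) => [k|] ->.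
  by rewrite lift_perm_lift permE; case: (sP k).
by rewrite lift_perm_id.
Qed.

(** Induction on [N]: the first value [k] exceeds exactly [k] later values, and [k] is also the
    parity by which [lift_perm ord0 k s'] differs from [s']. *)
Lemma odd_inversions_enum N (s : 'S_N) :
  odd (inversions [seq val (s r) | r <- enum 'I_N]) = odd_perm s.
Proof.
elim: N s => [|N IHN] s.
  rewrite (_ : s = 1%g) ?odd_perm1; last by apply/permP => -[].
  by rewrite (size0nil (s := enum _)) // size_enum_ord.
have [s' ->] := lift_permP s; set k := s ord0.
rewrite enum_ordSl /= odd_lift_perm lift_perm_id -map_comp.
rewrite (eq_map (g := fun r => bump k (s' r))) => [|r]; last by rewrite /= lift_perm_lift.
rewrite oddD /= (map_comp (bump k) (fun r => val (s' r))) inversions_map; last first.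
  by move=> x y; rewrite /bump; lia.
rewrite IHN; congr (_ (+) _); congr odd.
rewrite count_map (eq_count (a2 := fun y => (y < k)%N)) => [|y]; last first.
  by rewrite /= /bump; lia.
rewrite (map_comp val s') count_map -(finset_enumT N).
rewrite (seq.permP (perm_map_enum (perm_onT s'))) finset_enumT.
by rewrite count_lt_enum // -ltnS.
Qed.

(** Points outside [J] are fixed by [s]; adding them to [J] one by one keeps the parity, until [J]
    is the whole index set. *)
Lemma odd_inversions_perm_on N (s : 'S_N) (J : {set 'I_N}) : perm_on J s ->
  odd (inversions [seq val (s j) | j <- enum J]) = odd_perm s.
Proof.
have [k] := ubnP #|~: J|; elim: k J => // k IHk J ltJk Js.
have [J0|/finset.set0Pn[x xJ]] := eqVneq (~: J) finset.set0.
  have -> : J = [set: 'I_N] by rewrite -(finset.setCK J) J0 finset.setC0.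
  by rewrite finset_enumT odd_inversions_enum.
have xJ' : x \notin J by rewrite -finset.in_setC.
have Jxs : perm_on (x |: J) s by apply: fintype.subset_trans Js (finset.subsetUr _ _).
rewrite -(IHk (x |: J)) //; last first.
  have -> : ~: (x |: J) = ~: J :\ x by rewrite finset.setCU finset.setIC -finset.setDE.
  by move: ltJk; rewrite [in X in X -> _](finset.cardsD1 x) xJ.
have enumE (A : {set 'I_N}) : enum A = [seq r <- enum 'I_N | r \in A].
  by rewrite {1}/enum_mem -enumT.
pose a := [seq r : 'I_N <- [seq r : 'I_N <- enum 'I_N | (r < x)%N] | r \in J].
pose b := [seq r : 'I_N <- [seq r : 'I_N <- enum 'I_N | (x < r)%N] | r \in J].
have EJ : enum J = a ++ b.
  by rewrite enumE (enum_ord_cut x) filter_cat /= (negPf xJ').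
have EJx : enum (x |: J) = a ++ x :: b.
  rewrite enumE (enum_ord_cut x) filter_cat /= finset.setU11.
  congr (_ ++ _ :: _); apply: eq_in_filter => r; rewrite mem_filter finset.in_setU1;
    by case: eqP => // ->; rewrite ltnn.
rewrite EJx EJ !map_cat /= (out_perm Js) // odd_inversions_insert //.
  apply/mapP => -[y ya /val_inj xy]; move: xJ'; rewrite xy perm_closed //.
  by move: ya; rewrite mem_filter => /andP[->].
(* [s] permutes [J], so as many values as elements of [J] lie below [x], and these elements are
   exactly those of [a]. *)
rewrite -map_cat size_map -EJ (map_comp val s) count_map.
have /seq.permP -> := perm_map_enum Js.
rewrite EJ count_cat -[RHS]addn0; congr (_ + _)%N.
  by apply/eqP; rewrite -all_count; apply/allP => r; rewrite !mem_filter => /and3P[].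
apply/eqP; rewrite -leqn0 leqNgt -has_count; apply/hasPn => r /=.
by rewrite !mem_filter -leqNgt => /and3P[_ /ltnW].
Qed.

Lemma signr_inversions (Q : pzRingType) N (s : 'S_N) (J : {set 'I_N}) : perm_on J s ->
  (-1) ^+ inversions [seq val (s j) | j <- enum J] = (-1) ^+ s :> Q.
Proof. by move=> Js; rewrite -signr_odd odd_inversions_perm_on. Qed.

(** * Words as series, truncations and closed ideals *)

Section Words.
Variables (K : fieldType) (X : finType).
Implicit Types (u v w : seq X) (f g : ncseries K X).

Definition word w : ncseries K X := fun v => (v == w)%:R.

Lemma word_nil : word [::] = 1.
Proof. by apply/funext => -[]. Qed.

Lemma word_cat u v : word (u ++ v) = word u * word v.
Proof.
apply/funext => w; elim: u w => [|x u IHu] w; first by rewrite word_nil mul1r.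
case: w => [|y w]; first by rewrite ncs_mul_nil /word /= mul0r.
rewrite [RHS]ncs_mul_cons /word /= mul0r add0r -/(word u) -/(word v).
have -> : ncs_tail y (word (x :: u)) = (y == x)%:R *: word u.
  by apply/funext => z; rewrite ncs_scaleE /ncs_tail /word eqseq_cons -natrM mulnb.
rewrite -[ncs_mul _ _]/((_ *: word u) * word v) -scalerAl ncs_scaleE -IHu /word.
by rewrite -natrM mulnb -eqseq_cons.
Qed.

(** A finite combination of words agreeing with [f] below length [d]: closedness of an ideal lets
    series be replaced by these, and linearity then by single words. *)
Definition truncate d f : ncseries K X :=
  \sum_(k < d) \sum_(t : k.-tuple X) f t *: word t.

Lemma truncateE d f w : (size w < d)%N -> truncate d f w = f w.
Proof.
move=> ltwd; rewrite /truncate ncs_sumE (bigD1 (Ordinal ltwd)) //= ncs_sumE.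
rewrite (bigD1 (in_tuple w)) //= ncs_scaleE /word eqxx mulr1.
rewrite big1 ?addr0 => [|t neq_t]; last first.
  rewrite ncs_scaleE (_ : (w == t) = false) ?mulr0 //.
  by apply: contraNF neq_t => /eqP wt; apply/eqP/val_inj.
rewrite big1 ?addr0 // => k neq_k; rewrite ncs_sumE big1 // => t _.
rewrite ncs_scaleE (_ : (w == t) = false) ?mulr0 //.
apply: contraNF neq_k => /eqP wt; apply/eqP/val_inj => /=.
by rewrite wt size_tuple.
Qed.

Lemma truncate_ind (P : ncseries K X -> Prop) d f :
    P 0 -> (forall g h, P g -> P h -> P (g + h)) ->
    (forall (a : K) g, P g -> P (a *: g)) -> (forall w, P (word w)) ->
  P (truncate d f).
Proof.
by move=> P0 PD PZ Pw; apply: big_ind => // k _; apply: big_ind => // t _; apply: PZ.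
Qed.

Lemma closed_ideal_smallest (G : set (ncseries K X)) :
  closed_ideal (smallest (@closed_ideal K X) G).
Proof.
split=> [J [[] //]|f g If Ig J JG|f g Ig J JG|f g If J JG|f limf J JG];
  have [[J0 JD JMl JMr Jlim] _] := JG.
- by apply: JD; [apply: If|apply: Ig].
- by apply: JMl; apply: Ig.
- by apply: JMr; apply: If.
by apply: Jlim => d; have [g Ig gf] := limf d; exists g => //; apply: Ig.
Qed.

Lemma closed_idealZ (J : set (ncseries K X)) a f : closed_ideal J -> J f -> J (a *: f).
Proof. by move=> JI Jf; rewrite -[f]mul1r scalerAl; apply: closed_idealMl. Qed.

Lemma ncs_mul_neq0 f g w : (f * g) w != 0 ->
  exists u v, [/\ w = u ++ v, f u != 0 & g v != 0].
Proof.
rewrite ncs_mulE => fgw.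
have [k fgk] : exists k : 'I_(size w).+1, f (take k w) * g (drop k w) != 0.
  apply: contrapT => nk; case/eqP: fgw; apply: big1 => k _; apply/eqP.
  by apply: contrapT => fgk; apply: nk; exists k; apply/negP.
exists (take k w), (drop k w); rewrite cat_take_drop.
by move: fgk; rewrite mulf_eq0 negb_or => /andP[].
Qed.

End Words.

(** * The twist and the q-Cartier-Foata ideal *)

Lemma inversions_swap u v a b :
  (inversions (u ++ a :: b :: v) + (a < b) = inversions (u ++ b :: a :: v) + (b < a))%N.
Proof.
elim: u => [|x u IHu] /=; first by lia.
by rewrite !count_cat /=; lia.
Qed.

Section Twist.
Variables (K : fieldType) (m : nat) (q : K).
Hypothesis q_neq0 : q != 0.
Notation letters := ('I_m * 'I_m)%type.
Notation S := (ncseries K letters).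
Implicit Types (f g h : S) (w : seq letters).

Definition rows w : seq nat := [seq val x.1 | x <- w].
Definition cols w : seq nat := [seq val x.2 | x <- w].

Definition twist f : S := fun w => qweight q w * f w.

Lemma twist_is_linear : linear twist.
Proof.
move=> a f g; apply/funext => w.
by rewrite /twist !ncs_addE !ncs_scaleE /= mulrDr mulrCA.
Qed.

HB.instance Definition _ := GRing.isLinear.Build K S S *:%R twist twist_is_linear.

Lemma twist_word w : twist (word K w) = qweight q w *: word K w.
Proof.
apply/funext => v; rewrite ncs_scaleE /twist /word.
by case: eqP => [->|_] //; rewrite !mulr0.
Qed.

Lemma twist1 : twist 1 = 1.
Proof. by rewrite -word_nil twist_word /qweight subrr expr0z scale1r. Qed.

(** The exponent is 0, 1 or 2 according as [y.2] is above, equal to or below [x.2]: these are the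
    powers of [q] in the three families of relations. *)
Lemma qweight_swap w v (x y : letters) : (x.1 < y.1)%N ->
  qweight q (w ++ x :: y :: v) = qweight q (w ++ y :: x :: v) *
     q ^+ ((y.2 < x.2) + (y.2 <= x.2))%N.
Proof.
move=> ltxy; rewrite /qweight exprnP -expfzDr // !map_cat /=; congr (q ^ _).
have := inversions_swap (rows w) (rows v) x.1 y.1.
have := inversions_swap (cols w) (cols v) x.2 y.2.
rewrite ltxy (leq_gtF (ltnW ltxy)) /=; case: ltngtP => _; rewrite /rows /cols /=; lia.
Qed.

Section Ideal.
Let I : set S := smallest (@closed_ideal K _) (qCartierFoata q).
Let I_closed : closed_ideal I := closed_ideal_smallest _.

Lemma relation_in_ideal (x y : letters) : (x.1 < y.1)%N ->
  I (letter y * letter x -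
     q ^+ ((y.2 < x.2) + (y.2 <= x.2))%N *: (letter x * letter y)).
Proof.
move=> ltxy; apply: sub_gen_smallest; case: x y ltxy => [i k] [j l] /= ltij.
have lE a b : letter (a, b) = lettermx a b :> S by rewrite mxE.
rewrite !lE; case: ltngtP => [ltlk|ltkl|/val_inj ->] /=.
- exact: qCF_gt.
- by rewrite expr0 scale1r; apply: qCF_lt.
- by rewrite expr1; apply: qCF_eq.
Qed.

(* The weights turn commutation of letters from different rows into the
   q-Cartier-Foata relations, in every context. *)
Lemma twist_commutator (x y : letters) g h : x.1 != y.1 ->
  I (twist (g * (letter x * letter y - letter y * letter x) * h)).
Proof.
wlog ltxy : x y g / (y.1 < x.1)%N => [wlog_lt|_].
  rewrite neq_ltn => /orP[ltxy|ltyx]; last by apply: wlog_lt => //; rewrite neq_ltn ltyx orbT.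
  rewrite -[g]opprK mulNr -mulrN opprB; apply: wlog_lt => //.
  by rewrite neq_ltn ltxy orbT.
set c := _ - _; apply: closed_ideal_lim => // d.
(* The coefficient of a word shorter than [d] depends only on the truncations, so by closedness and
   linearity [g] and [h] may be taken to be words. *)
exists (twist (truncate d g * c * truncate d h)) => [|w ltwd]; last first.
  rewrite /twist; congr (_ * _); apply: ncs_mul_ext => v lev; last first.
    by rewrite truncateE // (leq_ltn_trans lev).
  apply: ncs_mul_ext => // u leu.
  by rewrite truncateE // (leq_ltn_trans leu) // (leq_ltn_trans lev).
have IZ a f : I f -> I (a *: f) by apply: closed_idealZ.
have ID f f' : I f -> I f' -> I (f + f') by apply: closed_idealD.
have I0 : I 0 by apply: closed_ideal0.
apply: (truncate_ind (P := fun g' => I (twist (g' * c * _)))) =>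
  [|g1 g2 I1 I2|a g1 I1|u].
- rewrite !mul0r linear0; exact: I0.
- by rewrite !mulrDl linearD; apply: ID.
- by rewrite -!scalerAl linearZ; apply: IZ.
apply: (truncate_ind (P := fun h' => I (twist (_ * c * h')))) =>
  [|h1 h2 I1 I2|a h1 I1|v].
- rewrite !mulr0 linear0; exact: I0.
- by rewrite [_ * (h1 + h2)]mulrDr linearD; apply: ID.
- by rewrite -!scalerAr linearZ; apply: IZ.
have cE (a b : letters) :
    word K u * (letter a * letter b) * word K v = word K (u ++ [:: a; b] ++ v).
  rewrite -[letter a]/(word K [:: a]) -[letter b]/(word K [:: b]) -!word_cat.
  by rewrite -catA.
(* The weights of the two words differ by the power of [q] in the relation, so the twist is a scalar
   multiple of the relation placed between two words. *)
rewrite /c mulrBr mulrBl linearB /= !cE !twist_word /= (qweight_swap _ _ ltxy).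
rewrite -scalerA -scalerBr; apply: IZ.
rewrite -(cE x y) -(cE y x) scalerAl scalerAr -mulrBl -mulrBr.
by apply: (closed_idealMr I_closed); apply: (closed_idealMl I_closed); apply: relation_in_ideal.
Qed.

End Ideal.

(** * Labels of words and multiplicativity of the twist *)

Section WordType.
Variable n : nat.

(* Only alpha and beta matter to the weight of a product: gamma stands for the
   intermediate labels, whose inversions cancel between rows and columns. *)
Definition has_type (alpha beta : seq nat) f := forall w, f w != 0 ->
  exists gamma, [/\ all (fun k => k < n)%N gamma,
    perm_eq (rows w) (gamma ++ alpha) & perm_eq (cols w) (gamma ++ beta)].

Lemma has_typeM alpha beta alpha' beta' f g :
    has_type alpha beta f -> has_type alpha' beta' g ->
  has_type (alpha ++ alpha') (beta ++ beta') (f * g).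
Proof.
move=> Tf Tg w /ncs_mul_neq0[u [v [-> /Tf[c [cn uc1 uc2]] /Tg[d [dn vd1 vd2]]]]].
exists (c ++ d); rewrite all_cat cn dn /rows /cols !map_cat; split=> //.
  by apply: perm_trans (perm_cat uc1 vd1) _; rewrite -!catA perm_cat2l perm_catCA.
by apply: perm_trans (perm_cat uc2 vd2) _; rewrite -!catA perm_cat2l perm_catCA.
Qed.

Lemma has_type1 : has_type [::] [::] 1.
Proof.
move=> [|x w]; last by rewrite ncs_oneE eqxx.
by exists [::].
Qed.

Lemma has_typeD alpha beta f g :
  has_type alpha beta f -> has_type alpha beta g -> has_type alpha beta (f + g).
Proof.
move=> Tf Tg w; rewrite ncs_addE; have [->|/Tf //] := eqVneq (f w) 0.
by rewrite add0r => /Tg.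
Qed.

Lemma has_type0 alpha beta : has_type alpha beta 0.
Proof. by move=> w; rewrite ncs_zeroE eqxx. Qed.

Lemma has_typeN alpha beta f : has_type alpha beta f -> has_type alpha beta (- f).
Proof. by move=> Tf w; rewrite ncs_oppE oppr_eq0 => /Tf. Qed.

Lemma has_type_sign alpha beta k f :
  has_type alpha beta f -> has_type alpha beta ((-1) ^+ k * f).
Proof.
move=> Tf; rewrite -signr_odd; case: (odd k); rewrite ?mulN1r ?mul1r //.
exact: has_typeN.
Qed.

Lemma has_type_letter x : has_type [:: val x.1] [:: val x.2] (letter x).
Proof.
move=> w; have [-> _|/negPf neq_w] := eqVneq w [:: x]; first by exists [::].
by rewrite /letter neq_w eqxx.
Qed.

Lemma has_type_prod (T : eqType) (l : seq T) (F : T -> S) (a b : T -> nat) :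
    {in l, forall j, has_type [:: a j] [:: b j] (F j)} ->
  has_type (map a l) (map b l) (\prod_(j <- l) F j).
Proof.
elim: l => [|j l IHl] TF; first by rewrite big_nil; apply: has_type1.
rewrite big_cons; apply: (@has_typeM [:: a j] [:: b j]); first exact/TF/mem_head.
by apply: IHl => i il; apply: TF; rewrite inE il orbT.
Qed.

(** Low labels occurring equally often in rows and columns can be counted among the intermediate
    ones. *)
Lemma has_type_cancel alpha beta f : perm_eq alpha beta ->
  all (fun k => k < n)%N alpha -> has_type alpha beta f -> has_type [::] [::] f.
Proof.
move=> ab an Tf w /Tf[c [cn w1 w2]]; exists (c ++ alpha); rewrite !cats0 all_cat cn.
by split=> //; apply: perm_trans w2 _; rewrite perm_cat2l perm_sym.
Qed.

Lemma cross_low alpha gamma : all (leq n) alpha -> all (fun k => k < n)%N gamma ->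
  cross gamma alpha = 0%N /\ cross alpha gamma = (size alpha * size gamma)%N.
Proof.
move=> an gn; split.
  rewrite /cross big_seq big1 // => x xg; apply/eqP; rewrite -leqn0 leqNgt -has_count.
  apply/hasPn => y ya; rewrite -leqNgt.
  by rewrite (leq_trans (ltnW (allP gn _ xg))) // (allP an).
elim: alpha an => [|x a IHa] /=; first by rewrite /cross big_nil.
case/andP=> nx an; rewrite /cross big_cons -/(cross a gamma) IHa // mulSn; congr (_ + _)%N.
apply/eqP; rewrite -all_count; apply/allP => y yg.
exact: leq_trans (allP gn _ yg) nx.
Qed.

Lemma qweight_cat u v : qweight q (u ++ v) = qweight q u * qweight q v *
   q ^ ((cross (cols u) (cols v))%:Z - (cross (rows u) (rows v))%:Z).
Proof.
rewrite /qweight -!expfzDr // !map_cat !inversions_cat; congr (q ^ _).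
by rewrite /rows /cols; lia.
Qed.

(** Intermediate labels of [f] and [g] contribute the same cross inversions to rows and columns:
    they are below [n], the other labels are at least [n], and [alpha] and [beta] have equal
    size. *)
Lemma twistM alpha beta alpha' beta' f g :
    has_type alpha beta f -> has_type alpha' beta' g -> size alpha = size beta ->
    all (leq n) (alpha ++ alpha') -> all (leq n) (beta ++ beta') ->
  twist (f * g) = q ^ ((cross beta beta')%:Z - (cross alpha alpha')%:Z) *:
                  (twist f * twist g).
Proof.
rewrite !all_cat => Tf Tg sz /andP[an an'] /andP[bn bn'].
apply/funext => w; rewrite ncs_scaleE /twist !ncs_mulE !mulr_sumr.
apply: eq_bigr => k _; set u := take k w; set v := drop k w.
have [fu|/Tf[c [cn u1 u2]]] := eqVneq (f u) 0; first by rewrite fu !(mul0r, mulr0).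
have [gv|/Tg[d [dn v1 v2]]] := eqVneq (g v) 0; first by rewrite gv !(mul0r, mulr0).
have -> : w = u ++ v by rewrite cat_take_drop.
rewrite qweight_cat (cross_perm u1 v1) (cross_perm u2 v2) !cross_catl !cross_catr.
rewrite (cross_low an' cn).1 (cross_low bn' cn).1 (cross_low an dn).2 (cross_low bn dn).2 sz.
set e := _ - _; set e' := _ - _; have -> : e = e' by rewrite /e /e'; lia.
by rewrite [X in X * _]mulrC -[LHS]mulrA; congr (_ * _); rewrite mulrACA.
Qed.

(** Each factor carries one label on each side, so the cross inversions of successive factors add up
    to the inversions of the two label words. *)
Lemma twist_prod (T : eqType) (l : seq T) (F : T -> S) (a b : T -> nat) :
    {in l, forall j, has_type [:: a j] [:: b j] (F j)} ->
    {in l, forall j, n <= a j}%N -> {in l, forall j, n <= b j}%N ->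
  twist (\prod_(j <- l) F j) =
  q ^ ((inversions (map b l))%:Z - (inversions (map a l))%:Z) *:
    \prod_(j <- l) twist (F j).
Proof.
elim: l => [|j l IHl] TF na nb.
  by rewrite !big_nil twist1 subrr expr0z scale1r.
have jl : {subset l <= j :: l} by move=> i il; rewrite inE il orbT.
have [[TF' na'] nb'] := (sub_in1 jl TF, sub_in1 jl na, sub_in1 jl nb).
rewrite !big_cons (twistM (TF j (mem_head _ _)) (has_type_prod TF')) //=; first last.
- by rewrite nb ?mem_head // all_map; apply/allP.
- by rewrite na ?mem_head // all_map; apply/allP.
rewrite IHl // -scalerAr scalerA -expfzDr //; congr (q ^ _ *: _).
rewrite /= /cross !big_seq1; lia.
Qed.

End WordType.

End Twist.

(** * Column determinants under morphisms and under the twist *)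

Lemma map_coldet (R Q : pzRingType) (pi : {rmorphism R -> Q}) N (X : 'M[R]_N) :
  pi (coldet X) = coldet (map_mx pi X).
Proof.
rewrite !coldetE rmorph_sum; apply: eq_bigr => s _.
rewrite rmorphM rmorph_sign rmorph_prod; congr (_ * _).
by apply: eq_bigr => r _; rewrite mxE.
Qed.

Lemma prod_seq_eq0 (Q : pzRingType) (T : eqType) (l : seq T) (F : T -> Q) x :
  x \in l -> F x = 0 -> \prod_(y <- l) F y = 0.
Proof.
by case/splitPr => u v Fx; rewrite big_cat big_cons Fx /= mul0r mulr0.
Qed.

Lemma signr_scale (K : fieldType) (A : lalgType K) k (a : A) :
  (-1) ^+ k * a = (-1 : K) ^+ k *: a.
Proof. by rewrite -[in LHS]signr_odd -[in RHS]signr_odd mulr_sign scaler_sign. Qed.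

Lemma detq_twist (K : fieldType) m (q : K) N (B : 'M[ncseries K ('I_m * 'I_m)]_N) :
  detq q B = twist q (coldet B).
Proof.
apply/funext => w; rewrite /detq /twist coldetE; congr (_ * _ w).
by apply: eq_bigr => s _; rewrite -finset_enumT signr_inversions // perm_onT.
Qed.

(** * Walks with low intermediate vertices *)

Section Walks.
Variables (K : fieldType) (m n : nat).
Notation letters := ('I_m * 'I_m)%type.
Notation S := (ncseries K letters).

(** The end [j] stays fixed in the recursion while the start [i] moves along the word; the empty
    word is no walk. *)
Fixpoint is_walk (j i : 'I_m) (w : seq letters) : bool :=
  if w is x :: w' then
    (x.1 == i) && (if nilp w' then x.2 == j else (x.2 < n)%N && is_walk j x.2 w')
  else false.

(* The generating series of the nonempty walks from i to j whose intermediate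
   vertices are less than n. *)
Definition walkmx : 'M[S]_m := \matrix_(i, j) (fun w => (is_walk j i w)%:R).

(** Decomposition by the first letter: it ends the walk, or leads to a low vertex [k] from which the
    walk goes on. *)
Lemma walkmxE i j : walkmx i j =
  lettermx i j + \sum_(k < m | (k < n)%N) lettermx i k * walkmx k j.
Proof.
rewrite big_mkcond; apply/funext => w; rewrite ncs_addE ncs_sumE mxE.
case: w => [|x w].
  rewrite mxE /letter /= add0r big1 // => k _.
  by case: ifP => // _; rewrite ncs_mul_nil !mxE /letter mul0r.
have tailE k : (lettermx i k * walkmx k j) (x :: w) =
    ((x == (i, k)) && is_walk j k w)%:R.
  rewrite [LHS]ncs_mul_cons !mxE /letter /= mul0r add0r.
  have -> : ncs_tail x (fun w => (w == [:: (i, k)])%:R : K) = (x == (i, k))%:R *: 1.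
    apply/funext => z; rewrite ncs_scaleE /ncs_tail ncs_oneE eqseq_cons -natrM mulnb.
    by case: z.
  rewrite -[ncs_mul _ _]/((_ *: 1) * (_ : S)) -scalerAl mul1r ncs_scaleE.
  by rewrite -natrM mulnb.
rewrite (eq_bigr (fun k : 'I_m => ((k < n)%N && (x == (i, k)) && is_walk j k w)%:R)).
  (* Only the vertex reached by the first letter contributes to the sum. *)
  rewrite (bigD1 x.2) //= big1 ?addr0 => [|k neq_k]; last first.
    by rewrite (_ : (x == _) = false) ?andbF //; apply: contraNF neq_k => /eqP ->.
  rewrite mxE /letter eqseq_cons; case: x {tailE} => a b /=; rewrite !xpair_eqE eqxx andbT.
  case: w => [|y w]; first by rewrite !andbF addr0 andbT.
  rewrite !andbF add0r /nilp /=; congr (_%:R); case: (a == i); case: (b < n)%N => //=.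
move=> k _; case: (k < n)%N; last by [].
exact: tailE.
Qed.

(** Each intermediate visit gives a column label on arrival and the same row label on departure. *)
Lemma has_type_walk i j : has_type n [:: val i] [:: val j] (walkmx i j).
Proof.
move=> w; rewrite mxE; have [iw _|] := boolP (is_walk j i w); last by rewrite eqxx.
elim: w i iw => //= x w IHw i /andP[/eqP <-].
case: w IHw => [_ /eqP <-|y w IHw /= /andP[xn /IHw [c [cn c1 c2]]]]; first by exists [::].
exists (val x.2 :: c); split; first by rewrite /= xn.
  apply: (@perm_trans _ ([:: val x.1] ++ (c ++ [:: val x.2]))); first by rewrite perm_cons.
  by rewrite perm_catC perm_cat2r perm_catC.
by rewrite -(perm_cons (val x.2)) in c2.
Qed.

End Walks.

(** * The Schur complement modulo the twist ideal *)

Section SchurIdentity.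
Variables (K : fieldType) (n p : nat) (q : K).
Hypothesis q_neq0 : q != 0.
Notation m := (n + p)%N.
Notation letters := ('I_m * 'I_m)%type.
Notation S := (ncseries K letters).
Variable le_nm : (n <= m)%N.
Notation I := (smallest (@closed_ideal K letters) (qCartierFoata q)).
Notation W := (walkmx K m n).
Notation A := (lettermx : 'M[S]_m).
Notation D := (coldet (1%:M - leadmx le_nm : 'M[S]_n)).
Notation Wc := (block_mx 0 0 0 (drsubmx W) : 'M[S]_(n + p)).
Notation high := [set i : 'I_m | (n <= i)%N].

(** The twist need not be multiplicative; asking for all multiples by [g] and [h] makes this a
    two-sided ideal. *)
Definition twist_ideal : set S := fun f => forall g h, I (twist q (g * f * h)).

Lemma twist_idealP : exists (Q : pzRingType) (pi : {rmorphism S -> Q}),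
  forall f, pi f = 0 <-> twist_ideal f.
Proof.
have IC : closed_ideal I := closed_ideal_smallest _.
apply: exists_quotient_morphism => [g h|f f' If If' g h|f' f If g h|f' f If g h].
- by rewrite mulr0 mul0r linear0; apply: closed_ideal0 IC.
- by rewrite mulrDr mulrDl linearD; apply: (closed_idealD IC); [apply: If|apply: If'].
- by rewrite mulrA; apply: If.
by rewrite mulrA -[_ * f' * h]mulrA; apply: If.
Qed.

Lemma twist_ideal_in f : twist_ideal f -> I (twist q f).
Proof. by move=> /(_ 1 1); rewrite mul1r mulr1. Qed.

(** Serves both I - A and the bordered matrix: integer constants are central, and letters in
    differently labelled rows commute in the quotient. *)
Lemma commuting_labelled_rows (Q : pzRingType) (pi : {rmorphism S -> Q}) N
    (B : 'M[S]_N) (c : 'I_N -> 'I_N -> nat) (row_label col_label : 'I_N -> 'I_m) :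
    (forall f, pi f = 0 <-> twist_ideal f) -> injective row_label ->
    (forall r k, B r k = (c r k)%:R - lettermx (row_label r) (col_label k)) ->
  commuting_rows (map_mx pi B).
Proof.
move=> piE labI BE r s k l neq_rs; rewrite !mxE !BE !rmorphB !rmorph_nat.
have := commr_nat; set a := pi (lettermx _ _); set b := pi (lettermx _ _) => comn.
have cab : GRing.comm a b.
  apply/eqP; rewrite -subr_eq0 -!rmorphM -rmorphB; apply/eqP/piE => g h.
  rewrite !mxE; apply: twist_commutator => //=.
  by rewrite (inj_eq labI).
apply: commrB; first exact: comn.
by apply: commr_sym; apply: commrB; [apply: comn|apply: commr_sym].
Qed.

Lemma leadmxE : leadmx le_nm = ulsubmx A.
Proof.
by apply/matrixP => i j; rewrite !mxE; congr (letter (_, _)); apply: val_inj.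
Qed.

Lemma walkmx_block : W = A + lsubmx A *m usubmx W.
Proof.
apply/matrixP => i j; rewrite [LHS]walkmxE [RHS]mxE; congr (_ + _).
rewrite [RHS]mxE big_mkcond big_split_ord /= [X in _ + X]big1 ?addr0 => [|k _].
  by apply: eq_bigr => k _; rewrite ltn_ord [lsubmx _ _ _]mxE [usubmx _ _ _]mxE.
by rewrite ltnNge leq_addr.
Qed.

(** The first equation reads (I - A_0) W_ur = A_ur; together they make I - W_dr the Schur complement
    of I - A_0 in I - A. *)
Lemma walkmx_blocks :
  ursubmx W = ursubmx A + ulsubmx A *m ursubmx W /\
  drsubmx W = drsubmx A + dlsubmx A *m ursubmx W.
Proof.
have Al : lsubmx A = col_mx (ulsubmx A) (dlsubmx A).
  by rewrite -{1}[A]submxK block_mxEh row_mxKl.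
have Wu : usubmx W = row_mx (ulsubmx W) (ursubmx W) by rewrite hsubmxK.
have := walkmx_block; rewrite Al Wu mul_col_row -{1}[W]submxK -{1}[A]submxK.
by rewrite add_block_mx => /eq_block_mx[_ ? _ ?].
Qed.

Lemma twist_idealB (f g : S) (Q : pzRingType) (pi : {rmorphism S -> Q}) :
  (forall f, pi f = 0 <-> twist_ideal f) -> pi f = pi g -> I (twist q f - twist q g).
Proof.
move=> piE fg; rewrite -linearB; apply: twist_ideal_in; apply/piE.
by rewrite rmorphB fg subrr.
Qed.

Lemma schur_mod_twist_ideal (Q : pzRingType) (pi : {rmorphism S -> Q}) :
    (forall f, pi f = 0 <-> twist_ideal f) ->
  pi (coldet (1%:M - A)) = pi (D * coldet (1%:M - Wc)).
Proof.
move=> piE.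
(* [Wc] is the high block of [W] padded with zeros, so that rows and columns keep their labels in
   ['I_m]; the padding contributes an identity block. *)
have -> : coldet (1%:M - Wc) = coldet (1%:M - drsubmx W).
  rewrite scalar_mx_block opp_block_mx add_block_mx !oppr0 !addr0.
  by rewrite coldet_lblock coldet_1 mul1r.
rewrite rmorphM !map_coldet; set M := map_mx pi (1%:M - A).
have MB : M = block_mx (map_mx pi (1%:M - ulsubmx A)) (map_mx pi (- ursubmx A))
                       (map_mx pi (- dlsubmx A)) (map_mx pi (1%:M - drsubmx A)).
  rewrite -map_block_mx; congr map_mx; rewrite -{1}[A]submxK scalar_mx_block.
  by rewrite opp_block_mx add_block_mx !add0r.
have comM : commuting_rows M.
  apply: (@commuting_labelled_rows _ _ _ _ (fun i j => (i == j)%N) id id) => // i j.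
  by rewrite !mxE.
have [urW dlW] := walkmx_blocks.
have ulW : (1%:M - ulsubmx A) *m ursubmx W = ursubmx A.
  by rewrite mulmxBl mul1mx {1}urW addrK.
(* The off-diagonal blocks of I - A are negated blocks of A, hence the sign of [H]. *)
rewrite (@coldet_schur _ _ _ M (- map_mx pi (ursubmx W))) // MB.
  rewrite block_mxKul block_mxKdl block_mxKdr leadmxE; congr (_ * _).
  by rewrite mulmxN opprK -map_mxM -map_mxD mulNmx dlW opprD addrA.
by rewrite block_mxKul block_mxKur mulmxN -map_mxM ulW map_mxN.
Qed.

(** Elimination with a single extra row and column: the walks into [j] from low vertices solve the
    linear system, and the Schur complement is the 1 by 1 matrix with entry [- W i j]. *)
Lemma border_mod_twist_ideal (Q : pzRingType) (pi : {rmorphism S -> Q}) (i j : 'I_m) :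
    (forall f, pi f = 0 <-> twist_ideal f) -> (n <= i)%N ->
  pi (coldet (bordermx K le_nm i j)) = pi (- (D * W i j)).
Proof.
move=> piE len_i; rewrite map_coldet; set B := bordermx _ _ _ _.
pose lab k (r : 'I_(n + 1)) : 'I_m :=
  match fintype.split r with inl r' => widen_ord le_nm r' | inr _ => k end.
have comB : commuting_rows (map_mx pi B).
  (* The constant part is the identity on the leading block and 0 on the border, also in the corner
     when [i = j]. *)
  pose c (r s : 'I_(n + 1)) : nat :=
    match fintype.split r, fintype.split s with inl r', inl s' => (r' == s')%N | _, _ => 0%N end.
  apply: (@commuting_labelled_rows _ _ _ _ c (lab i) (lab j)) => // [r s|r s].
    (* [n <= i] keeps the label [i] apart from those of the leading rows. *)
    rewrite -[r]splitK -[s]splitK /lab !unsplitK.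
    case: (fintype.split r) (fintype.split s) => [r'|r'] [s'|s'] /= eq_rs.
    - by congr (lshift _ _); apply: val_inj; apply: (congr1 val eq_rs).
    - by have := ltn_ord r'; rewrite ltnNge -[val r']/(val (widen_ord le_nm r')) eq_rs len_i.
    - by have := ltn_ord s'; rewrite ltnNge -[val s']/(val (widen_ord le_nm s')) -eq_rs len_i.
    - by rewrite !ord1.
  rewrite /c /lab -[r]splitK -[s]splitK !unsplitK.
  case: (fintype.split r) (fintype.split s) => [r'|r'] [s'|s'] /=.
  - by rewrite block_mxEul !mxE.
  - by rewrite block_mxEur !mxE sub0r.
  - by rewrite block_mxEdl !mxE sub0r.
  - by rewrite block_mxEdr !mxE sub0r.
pose H : 'cV[S]_n := \col_r walkmx K m n (widen_ord le_nm r) j.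
have BE : map_mx pi B = block_mx (map_mx pi (1%:M - leadmx le_nm))
    (map_mx pi (- \col_r lettermx (widen_ord le_nm r) j))
    (map_mx pi (- \row_r lettermx i (widen_ord le_nm r)))
    (map_mx pi (const_mx (- lettermx i j))) by rewrite -map_block_mx.
have sumE k : \sum_r lettermx k (widen_ord le_nm r) * H r 0 =
    \sum_(r < m | (r < n)%N) lettermx k r * walkmx K m n r j.
  rewrite (big_ord_narrow le_nm); apply: eq_bigr => r _.
  by rewrite [H _ _]mxE.
rewrite (coldet_schur (H := - map_mx pi H)) // BE.
  rewrite block_mxKul block_mxKdl block_mxKdr rmorphN rmorphM map_coldet -mulrN.
  congr (_ * _); rewrite coldet_mx11 mulmxN opprK -map_mxM -map_mxD mxE -rmorphN.
  congr (pi _); rewrite walkmxE opprD -sumE mulNmx [LHS]mxE [const_mx _ _ _]mxE.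
  rewrite [X in _ + X = _]mxE [X in _ - X = _]mxE; congr (_ - _).
  by apply: eq_bigr => r _; rewrite [X in X * _]mxE.
rewrite block_mxKul block_mxKur mulmxN -map_mxM map_mxN; congr (- map_mx _ _).
apply/matrixP => r z; rewrite ord1 mulmxBl mul1mx [RHS]mxE [LHS]mxE [H _ _]mxE.
rewrite walkmxE -sumE [X in _ + X = _]mxE [X in _ - X = _]mxE -[RHS]addr0 -addrA.
congr (_ + _); apply/eqP; rewrite subr_eq0; apply/eqP.
by apply: eq_bigr => k _; rewrite [leadmx _ _ _]mxE.
Qed.

End SchurIdentity.

(** * Weights in the walk determinant and the final identity *)

Section FinalIdentity.
Variables (K : fieldType) (n p : nat) (q : K).
Hypothesis q_neq0 : q != 0.
Notation m := (n + p)%N.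
Notation letters := ('I_m * 'I_m)%type.
Notation S := (ncseries K letters).
Variable le_nm : (n <= m)%N.
Notation I := (smallest (@closed_ideal K letters) (qCartierFoata q)).
Notation W := (walkmx K m n).
Notation A := (lettermx : 'M[S]_m).
Notation D := (coldet (1%:M - leadmx le_nm : 'M[S]_n)).
Notation Wc := (block_mx 0 0 0 (drsubmx W) : 'M[S]_(n + p)).
Notation high := [set i : 'I_m | (n <= i)%N].

(** In each term the row labels are a permutation of the column labels and all are below [n], so
    they count as intermediate. *)
Lemma has_type_lead_det : has_type n [::] [::] D.
Proof.
rewrite coldet_1sub.
apply: (big_ind (has_type n [::] [::])) => [||J _]; [exact: has_type0|exact: has_typeD|].
apply: has_type_sign.
apply: (big_ind (has_type n [::] [::])) => [||s Js]; [exact: has_type0|exact: has_typeD|].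
apply: has_type_sign.
apply: (@has_type_cancel _ _ _ [seq val (s j) | j <- enum J] [seq val j | j <- enum J]).
- by rewrite (map_comp val s); apply/perm_map/perm_map_enum.
- by apply/allP => _ /mapP[j _ ->] /=.
by apply: has_type_prod => j _; rewrite !mxE; apply: has_type_letter.
Qed.

Lemma twist_lead_detM alpha beta f : has_type n alpha beta f ->
    size alpha = size beta -> all (leq n) alpha -> all (leq n) beta ->
  twist q (D * f) = twist q D * twist q f.
Proof.
move=> Tf sz an bn; rewrite (twistM q_neq0 has_type_lead_det Tf) //.
by rewrite /cross !big_nil subrr expr0z scale1r.
Qed.

Lemma walk_blockE r s : Wc r s = if (n <= r)%N && (n <= s)%N then W r s else 0.
Proof.
rewrite -[r]splitK -[s]splitK.
case: (fintype.split r) (fintype.split s) => [i|i] [j|j] /=.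
- by rewrite block_mxEul [LHS]mxE leqNgt ltn_ord.
- by rewrite block_mxEur [LHS]mxE leqNgt ltn_ord.
- by rewrite block_mxEdl [LHS]mxE leq_addr leqNgt ltn_ord.
by rewrite block_mxEdr !leq_addr /drsubmx [LHS]mxE [LHS]mxE.
Qed.

Lemma sorted_enum_ord N (J : {set 'I_N}) : sorted ltn [seq val j | j <- enum J].
Proof.
apply: (@subseq_sorted _ _ ltn_trans _ (map val (enum 'I_N))).
  by apply: map_subseq; rewrite {1}/enum_mem -enumT; apply: filter_subseq.
by rewrite val_enum_ord iota_ltn_sorted.
Qed.

(** In the term of [J] and [s] the column labels increase, so the twist contributes [q] to the power
    minus the inversions of [s] on [J]; with the sign of [s] this is the power of [- q] in
    [detq_letters]. *)
Lemma twist_lead_det_walks :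
  twist q (D * coldet (1%:M - Wc)) =
  twist q D * detq_letters q high (fun i j => twist q (W i j)).
Proof.
rewrite [coldet (_ - Wc)]coldet_1sub mulr_sumr linear_sum /detq_letters mulr_sumr.
rewrite [RHS]big_mkcond /=.
apply: eq_bigr => J _.
have WcE s : perm_on J s -> J \subset high ->
    \prod_(j <- enum J) Wc (s j) j = \prod_(j <- enum J) W (s j) j.
  move=> Js /fintype.subsetP Jhigh; apply: eq_big_seq => j; rewrite mem_enum => jJ.
  have := Jhigh j jJ; have := Jhigh (s j).
  by rewrite (perm_closed _ Js) !finset.inE => /(_ jJ) sjn jn; rewrite walk_blockE sjn jn.
case: ifP => [Jhigh|/negbT nJ].
  rewrite !signr_scale -!scalerAr linearZ; congr (_ *: _).
  rewrite !mulr_sumr linear_sum; apply: eq_bigr => s Js.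
  rewrite signr_scale -!scalerAr linearZ /= WcE //.
  have Jn j : j \in J -> (n <= j)%N.
    by move: Jhigh => /fintype.subsetP/(_ j) + jJ => /(_ jJ); rewrite finset.inE.
  have sJn j : j \in J -> (n <= s j)%N by move=> jJ; apply: Jn; rewrite perm_closed.
  have TW : {in enum J, forall j, has_type n [:: val (s j)] [:: val j] (W (s j) j)}.
    by move=> j _; apply: has_type_walk.
  rewrite (twist_lead_detM (has_type_prod TW)) ?size_map //; first last.
  - by apply/allP => _ /mapP[j jJ ->]; apply: Jn; rewrite -mem_enum.
  - by apply/allP => _ /mapP[j jJ ->]; apply: sJn; rewrite -mem_enum.
  rewrite (twist_prod q_neq0 TW) => [|j|j]; rewrite ?mem_enum; [|exact: sJn|exact: Jn].
  rewrite -scalerAr scalerA (inversions_sorted (sorted_enum_ord J)) sub0r.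
  congr (_ *: _); rewrite -(signr_inversions _ Js) -exprnN.
  by rewrite -[in RHS]mulN1r exprMn invfM invr_sign.
(* If [J] has a low element, the factor of [Wc] in that column is zero. *)
suff -> : \sum_(s | perm_on J s) (-1) ^+ s * \prod_(j <- enum J) Wc (s j) j = 0.
  by rewrite !mulr0 linear0.
apply: big1 => s Js.
have [j jJ jn] : exists2 j, j \in J & ~~ (n <= j)%N.
  by case/fintype.subsetPn: nJ => j jJ; rewrite finset.inE; exists j.
by rewrite (@prod_seq_eq0 _ _ _ _ j) ?mulr0 ?mem_enum // walk_blockE (negPf jn) andbF.
Qed.

(** Lets the entries treated as letters be replaced by congruent ones. *)
Lemma detq_letters_morph (P : pzRingType) (rho : {rmorphism S -> P})
    (C C' : 'I_m -> 'I_m -> S) (H : {set 'I_m}) :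
    (forall i j, i \in H -> j \in H -> rho (C i j) = rho (C' i j)) ->
  rho (detq_letters q H C) = rho (detq_letters q H C').
Proof.
move=> CC'; rewrite /detq_letters !rmorph_sum; apply: eq_bigr => J /fintype.subsetP JH.
rewrite !rmorphM; congr (_ * _); rewrite !rmorph_sum; apply: eq_bigr => s Js.
rewrite -[in LHS]mulr_algl -[in RHS]mulr_algl !rmorphM; congr (_ * _).
rewrite !rmorph_prod; apply: eq_big_seq => j; rewrite mem_enum => jJ.
by apply: CC'; apply: JH; rewrite ?perm_closed.
Qed.

Lemma coldet_nil N (B : 'M[S]_N) :
  coldet B [::] = coldet (map_mx (fun f : S => f [::]) B).
Proof.
have evB : zmod_morphism (fun f : S => f [::]) by move=> f g.
have evM : monoid_morphism (fun f : S => f [::]).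
  by split=> // f g; apply: ncs_mul_nil.
pose ev : {rmorphism S -> K} := HB.pack (fun f : S => f [::])
  (GRing.isZmodMorphism.Build S K _ evB) (GRing.isMonoidMorphism.Build S K _ evM).
exact: (map_coldet ev).
Qed.

(** Letters have no constant term, so [D] has constant term det I = 1, and the empty word has weight
    1; a series with nonzero constant term is invertible. *)
Lemma unit_twist_lead_det : twist q D \is a GRing.unit.
Proof.
suff D1 : D [::] = 1.
  by rewrite unfold_in /= /ncs_unit /twist D1 mulr1 /qweight subrr expr0z oner_eq0.
rewrite coldet_nil -[RHS](@coldet_1 K n); congr coldet.
apply/matrixP => i j; rewrite !mxE ncs_addE ncs_oppE /letter /= subr0.
by case: (i == j).
Qed.

Lemma detq_schur :
  eqmod_closed_ideal (qCartierFoata q)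
    ((detq q (1%:M - leadmx le_nm))^-1 * detq q (1%:M - A))
    (detq_letters q high (cq q le_nm)).
Proof.
have IC : closed_ideal I := closed_ideal_smallest _.
(* Two quotients: [pi] kills the twist ideal and is where determinants are computed, [rho] kills the
   q-Cartier-Foata ideal and is where the identity is asserted. Equality under [pi] gives equality
   of the twists under [rho]. *)
have [Q [pi piE]] := twist_idealP n p q.
have [P [rho rhoE]] := exists_quotient_morphism (closed_ideal0 IC)
  (closed_idealD IC) (closed_idealMl IC) (fun a x => @closed_idealMr _ _ _ IC x a).
have rho_twist f g : pi f = pi g -> rho (twist q f) = rho (twist q g).
  move=> fg; apply/eqP; rewrite -subr_eq0 -rmorphB; apply/eqP/rhoE.
  exact: twist_idealB piE fg.
have Dunit := unit_twist_lead_det.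
apply/rhoE; rewrite rmorphB; apply/eqP; rewrite subr_eq0; apply/eqP.
rewrite !detq_twist rmorphM (rho_twist _ _ (schur_mod_twist_ideal q_neq0 le_nm piE)).
rewrite twist_lead_det_walks -rmorphM mulKr //.
apply: detq_letters_morph => i j; rewrite !finset.inE => ni nj.
(* The bordered determinant becomes the twist of [- (D * W i j)], which splits; cancelling
   [twist q D] leaves [twist q (W i j)], the entry in the expansion over walks. *)
rewrite /cq !detq_twist rmorphN rmorphM.
rewrite (rho_twist _ _ (border_mod_twist_ideal q_neq0 le_nm j piE ni)) linearN /=.
rewrite (twist_lead_detM (@has_type_walk K m n i j)) //= ?ni ?nj //.
by rewrite -rmorphM mulrN mulKr // rmorphN opprK.
Qed.

End FinalIdentity.

Theorem theorem7p6 (R : realType) (m n : nat) (q : R[i])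
    (n_ge1 : (1 <= n)%N) (lt_nm : (n < m)%N) (q_neq0 : q != 0) :
  eqmod_closed_ideal (qCartierFoata q)
    ((detq q (1%:M - leadmx (ltnW lt_nm)))^-1 * detq q (1%:M - lettermx))
    (detq_letters q [set i : 'I_m | (n <= i)%N] (cq q (ltnW lt_nm))).
Proof.
(* Writing [m] as [n + p] makes the block decomposition available. *)
have [p mE] : exists p, m = (n + p)%N by exists (m - n)%N; rewrite subnKC // ltnW.
by subst m; apply: detq_schur.
Qed.
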